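(* Let $(X,d_X)$ be a metric space with an average $\boxplus$ which assigns to any $\Lambda_0,\dots,\Lambda_n\in X$ and $\alpha_0,\dots,\alpha_n\in[0,1]$ with $\sum_{i=0}^n\alpha_i=1$ an element $\boxplus_{i=0}^n\alpha_i\Lambda_i\in X$ such that $$d_X\Big(\Lambda_j,\boxplus_{i=0}^n\alpha_i\Lambda_i\Big)\le\sum_{i=0}^n\alpha_i\,d_X(\Lambda_j,\Lambda_i),\qquad j\in\{0,\dots,n\}.$$ Let $K\subset\mathbb R^d$ be compact. For $n\in\mathbb N$ let $p_{n,0},\dots,p_{n,l_n}\in K$ and let $c_{n,i}:K\to[0,\infty)$, $i=0,\dots,l_n$, satisfy $\sum_{i=0}^{l_n}c_{n,i}(p)=1$ for all $p\in K$. Assume that for every $p\in K$, $\delta_n(p)=\min_{0\le i\le l_n}\|p-p_{n,i}\|\to0$ as $n\to\infty$. For $f:K\to\mathbb R$ and $G:K\to X$ define $$\widetilde O_n(f,p)=\sum_{i=0}^{l_n}c_{n,i}(p)f(p_{n,i}),\qquad O_n(G,p)=\boxplus_{i=0}^{l_n}c_{n,i}(p)G(p_{n,i}).$$ Assume that for any continuous $f:K\to\mathbb R$ and any $\epsilon>0$ there exists $\widetilde N_{f,\epsilon}$ such that $|f(p)-\widetilde O_n(f,p)|<\epsilon$ for all $n\ge\widetilde N_{f,\epsilon}$ and all $p\in K$. Then for any continuous $G:K\to X$ and any $\epsilon>0$ there exists $N_{G,\epsilon}$ such that $d_X(G(p),O_n(G,p))<\epsilon$ for all $n\ge N_{G,\epsilon}$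 and all $p\in K$.
   Context: $\|\cdot\|$ is the Euclidean norm on $\mathbb R^d$. *)

(* Defs.v *)
From HB Require Import structures.
From mathcomp Require Import all_boot all_order all_algebra.
From mathcomp Require Import all_classical all_reals all_analysis.

Set Implicit Arguments.
Unset Strict Implicit.
Unset Printing Implicit Defensive.

Import Order.TTheory GRing.Theory Num.Theory.
Import numFieldNormedType.Exports.

Local Open Scope classical_set_scope.
Local Open Scope ring_scope.

(* The norm that the library attaches to row vectors is the sup norm, hence
   the explicit definition. Both norms induce the same topology, so compactness
   and continuity on ['rV[R]_d] are taken from the library. *)
Definition euclidean_norm (R : realType) (d : nat) (x : 'rV[R]_d) : R :=
  Num.sqrt (\sum_(i < d) x ord0 i ^+ 2).

(* An averaging operation is a total function of the points and the weights;
   its values are constrained only when the weights are convex. *)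
Definition is_average (R : realType) (X : metricType R)
    (avg : forall n : nat, ('I_n.+1 -> R) -> ('I_n.+1 -> X) -> X) : Prop :=
  forall (n : nat) (a : 'I_n.+1 -> R) (L : 'I_n.+1 -> X),
    (forall i, 0 <= a i <= 1) -> \sum_(i < n.+1) a i = 1 ->
    forall j : 'I_n.+1,
      mdist (L j) (avg n a L) <= \sum_(i < n.+1) a i * mdist (L j) (L i).

(* Minimum over the nonempty index set ['I_m.+1]; the default value of the
   iterated minimum is the term of index 0. *)
Definition min_dist (R : realType) (d m : nat) (P : 'I_m.+1 -> 'rV[R]_d)
    (p : 'rV[R]_d) : R :=
  \big[Num.min/euclidean_norm (p - P ord0)]_(i < m.+1)
    euclidean_norm (p - P i).

Definition scalar_operator (R : realType) (d m : nat)
    (P : 'I_m.+1 -> 'rV[R]_d) (c : 'I_m.+1 -> 'rV[R]_d -> R)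
    (f : 'rV[R]_d -> R) (p : 'rV[R]_d) : R :=
  \sum_(i < m.+1) c i p * f (P i).

Definition average_operator (R : realType) (X : metricType R)
    (avg : forall n : nat, ('I_n.+1 -> R) -> ('I_n.+1 -> X) -> X)
    (d m : nat) (P : 'I_m.+1 -> 'rV[R]_d) (c : 'I_m.+1 -> 'rV[R]_d -> R)
    (G : 'rV[R]_d -> X) (p : 'rV[R]_d) : X :=
  avg m (fun i => c i p) (fun i => G (P i)).

(* Main.v *)
(* Apply the scalar approximation property to the functions d(G q, G _). At p
   close to q it makes the weighted sum of the d(G q, G p_i) small; by
   averaging, some single node G p_j is then also close to G q, so the
   inequality for the average can be used at L_j = G p_j. Compactness of K
   reduces uniformity in p to finitely many q. *)
Require Import Defs.
From HB Require Import structures.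
From mathcomp Require Import all_boot all_order all_algebra.
From mathcomp Require Import all_classical all_reals all_analysis.
From mathcomp Require Import lra.
Import Order.TTheory GRing.Theory Num.Theory.
Import numFieldNormedType.Exports.

Local Open Scope classical_set_scope.
Local Open Scope ring_scope.

Lemma continuous_mdist (R : realType) (X : metricType R) (x : X) :
  continuous (mdist x : X -> R).
Proof.
move=> y; apply/cvgrPdist_lt => e e0.
near=> z; have yz : mdist y z < e.
  near: z; have := nbhsx_ballx y e e0.
  by rewrite ballEmdist.
have := metric_triangle x y z; have := metric_triangle x z y.
rewrite (metric_sym z y) ltr_norml; lra.
Unshelve. all: by end_near. Qed.

(** A minimizer [j] of [F] works: since the weights sum to 1, [F j] is the weighted mean of the
    constant [F j], and this is bounded termwise. *)
Lemma exists_le_convex_sum (R : realType) (n : nat) (a F : 'I_n.+1 -> R) :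
  (forall i, 0 <= a i) -> \sum_(i < n.+1) a i = 1 ->
  exists j, F j <= \sum_(i < n.+1) a i * F i.
Proof.
move=> a0 a1; have [j _ Fj] := arg_minP F (erefl : xpredT (@ord0 n)).
exists j; rewrite -[F j]mul1r -a1 mulr_suml.
by apply: ler_sum => i _; rewrite ler_wpM2l ?Fj.
Qed.

(** [is_average] bounds only distances from the averaged points, whereas [x] is arbitrary, so the
    path goes through some [L j]. Let S be the sum on the right. A suitable [j] has d(x, L j) <= S,
    and then d(L j, avg) <= d(x, L j) + S <= 2S, which gives the factor 3. *)
Lemma mdist_average_le (R : realType) (X : metricType R)
    (avg : forall n : nat, ('I_n.+1 -> R) -> ('I_n.+1 -> X) -> X) :
  is_average avg ->
  forall (n : nat) (a : 'I_n.+1 -> R) (L : 'I_n.+1 -> X) (x : X),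
    (forall i, 0 <= a i) -> \sum_(i < n.+1) a i = 1 ->
    mdist x (avg n a L) <= 3 * \sum_(i < n.+1) a i * mdist x (L i).
Proof.
move=> havg n a L x a0 a1.
have a01 i : 0 <= a i <= 1.
  by rewrite a0 -a1 (bigD1 i)//= lerDl sumr_ge0.
have [j xLj] := @exists_le_convex_sum R n a (fun i => mdist x (L i)) a0 a1.
have Ljavg := havg n a L a01 a1 j.
(* The triangle inequality through [x], averaged over [i]; the constant d(x, L j) survives unchanged
   because the weights sum to 1. *)
have tri : \sum_(i < n.+1) a i * mdist (L j) (L i) <=
    mdist x (L j) + \sum_(i < n.+1) a i * mdist x (L i).
  rewrite -[mdist x (L j)]mul1r -a1 mulr_suml -big_split/=.
  apply: ler_sum => i _; rewrite -mulrDr ler_wpM2l//.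
  by rewrite (metric_sym x (L j)) metric_triangle.
have := metric_triangle x (L j) (avg n a L); move: xLj Ljavg tri => /=; lra.
Qed.

Theorem mainTheorem8 (R : realType) (X : metricType R)
    (avg : forall n : nat, ('I_n.+1 -> R) -> ('I_n.+1 -> X) -> X)
    (havg : is_average avg)
    (d : nat) (K : set 'rV[R]_d) (hK : compact K)
    (l : nat -> nat)
    (P : forall n : nat, 'I_(l n).+1 -> 'rV[R]_d)
    (hP : forall (n : nat) (i : 'I_(l n).+1), K (P n i))
    (c : forall n : nat, 'I_(l n).+1 -> 'rV[R]_d -> R)
    (hc0 : forall (n : nat) (i : 'I_(l n).+1) (p : 'rV[R]_d),
      K p -> 0 <= c n i p)
    (hc1 : forall (n : nat) (p : 'rV[R]_d),
      K p -> \sum_(i < (l n).+1) c n i p = 1)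
    (hdelta : forall p : 'rV[R]_d,
      K p -> min_dist (P n) p @[n --> \oo] --> (0 : R))
    (happrox : forall f : 'rV[R]_d -> R, {within K, continuous f} ->
      forall eps : R, 0 < eps ->
      exists N : nat, forall n : nat, (N <= n)%N ->
      forall p : 'rV[R]_d, K p ->
        `|f p - scalar_operator (P n) (c n) f p| < eps) :
  forall G : 'rV[R]_d -> X, {within K, continuous G} ->
  forall eps : R, 0 < eps ->
  exists N : nat, forall n : nat, (N <= n)%N ->
  forall p : 'rV[R]_d, K p ->
    mdist (G p) (average_operator avg (P n) (c n) G p) < eps.
Proof.
move=> G Gcont eps eps0.
(* The 7 is 1 + 3 * 2: one share for d(G p, G q), and three times a weighted sum that stays below
   two shares. *)
have e0 : 0 < eps / 7 by rewrite divr_gt0.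
suff [N _ HN] : \forall n \near \oo, K `<=` fun p =>
    mdist (G p) (average_operator avg (P n) (c n) G p) < eps.
  by exists N => n Nn p Kp; exact: HN.
(* Compactness as a near-covering property: it suffices to treat [p] near a fixed [q] in [K] and [n]
   large, so the threshold may depend on [q]. *)
have /compact_near_coveringP/near_covering_withinP := hK; apply => q Kq.
have fcont : {within K, continuous (fun x => mdist (G q) (G x))}.
  by move=> x; apply: continuous_comp; [exact: Gcont | exact: continuous_mdist].
have [N HN] := happrox _ fcont _ e0.
have near_q : \forall p \near q, K p -> mdist (G q) (G p) < eps / 7.
  have /subspace_continuousP/(_ q Kq)/cvg_ball/(_ _ e0) := Gcont.
  by rewrite near_withinE ballEmdist.
near=> p n => /= Kp.
have qp : mdist (G q) (G p) < eps / 7 by move: Kp; near: p.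
have Nn : (N <= n)%N by near: n; exact: nbhs_infty_ge.
(* Only the upper bound on the scalar operator is kept: the weighted sum of the d(G q, G p_i) is
   below d(G q, G p) + eps / 7, hence below 2 * eps / 7. *)
have := HN n Nn p Kp; rewrite ltr_norml => /andP[scal _].
have := @mdist_average_le R X avg havg _ _ (fun i => G (P n i)) (G q)
  (fun i => hc0 n i p Kp) (hc1 n p Kp).
have := metric_triangle (G p) (G q) (average_operator avg (P n) (c n) G p).
rewrite (metric_sym (G p) (G q)) /average_operator.
move: scal; rewrite /scalar_operator; lra.
Unshelve. all: by end_near. Qed.
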